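(* Fix an integer $p\ge1$ and $c\in\mathbb R$, and put $\lambda:=e^{-c}$, $r:=p\lambda$. For each $n\ge 1$ let $\mu_n$ be a probability mass function on $\{0,\dots,n\}$, extended by $\mu_n(a)=0$ for $a\notin\{0,\dots,n\}$, and let $M_n:=\widetilde Q_{\mu_n,p}=\sum_{u=0}^n\mu_n(n-u)\widetilde Q_{n-u,p}$, a probability measure on $G_{n,p}$. Assume that $$\mu_n(n-u)\longrightarrow e^{-\lambda}\frac{\lambda^u}{u!}\quad(n\to\infty)\qquad\text{for each fixed }u\ge0.$$ (a) Then $\|M_n-U\|_{\mathrm{TV}}\to f_p(c)$ and $\mathrm{sep}(M_n,U)\to s_p(c)$. (b) If in addition there exists $B\ge1$ such that, for all sufficiently large $n$ and all $u\ge0$, $0\le\mu_n(n-u)\,u!\,p^u\le B^u$, then for every $1\le q<\infty$ $$\left\|\frac{M_n(\cdot)}{U(\cdot)}-1\right\|_{L^q(U)}^q\longrightarrow H_{q,p}(c),\qquad D(M_n\|U)\longrightarrow h_p(c).$$ In particular, $\chi^2(M_n,U)\to H_{2,p}(c)=g_p(c)$. (c) Assume, in the case $r<1$, that there exists a summable sequence $(b_u)_{u\ge0}$ such that, for all sufficiently large $n$ and all $u\ge0$, $0\le\mu_n(n-u)\,u!\,p^u\le b_u$ (no such assumption is made when $r\ge1$). Then, with convergence understood in the extended interval $[0,\infty]$, $$\left\|\frac{M_n(\cdot)}{U(\cdot)}-1\right\|_{L^\infty(U)}\longrightarrow H_{\infty,p}(c).$$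
   Context: For integers $n,p\ge1$, $C_p=\mathbb Z/p\mathbb Z$ (written additively) and $G_{n,p}=C_p\wr S_n$ is the group of $p$-colored permutations, realized as $C_p^{\,n}\times S_n$ with multiplication $(t,\tau)(s,\sigma)=(\sigma t+s,\tau\sigma)$, $\sigma t:=(t_{\sigma(1)},\dots,t_{\sigma(n)})$. In $(s,\sigma)$, position $i$ carries the label $\sigma(i)$ with color $s_i$. $U$ is the uniform law on $G_{n,p}$. For $0\le u\le n$, $A_u\subseteq G_{n,p}$ is the set of $(s,\sigma)$ with $\sigma^{-1}(n-u+1)<\cdots<\sigma^{-1}(n)$ and $s_{\sigma^{-1}(j)}=0$ for $n-u+1\le j\le n$ (so $A_0=G_{n,p}$), and $\widetilde Q_{n-u,p}$ is the uniform probability measure on $A_u$. For a probability measure $M$ on $G_{n,p}$: $\|M-U\|_{\mathrm{TV}}=\frac12\sum_x|M(x)-U(x)|$; $\mathrm{sep}(M,U)=1-\min_xM(x)/U(x)$; $\|f\|_{L^q(U)}=(\sum_x|f(x)|^qU(x))^{1/q}$ for $1\le q<\infty$ and $\|f\|_{L^\infty(U)}=\max_x|f(x)|$; $\chi^2(M,U)=\|M/U-1\|_{L^2(U)}^2$; $D(M\|U)=\sum_xM(x)\log\frac{M(x)}{U(x)}$ with $0\log0:=0$. Profile functions, with $\lambda=e^{-c}$ and $r=p\lambda$: $s(\ell):=e^{-\lambda}\sum_{u=0}^{\ell}r^u$, $\quad a_\ell:=\frac{1}{\ell!\,p^\ell}-\frac{1}{(\ell+1)!\,p^{\ell+1}}$,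 $\quad w^*:=\min\{\ell\ge0: s(\ell)>1\}$ (which exists and is $\ge1$), $$f_p(c):=1-e^{-\lambda}\sum_{u=0}^{w^*-1}\frac{\lambda^u}{u!}+\frac{e^{-\lambda}\sum_{u=0}^{w^*-1}r^u-1}{w^*!\,p^{w^*}},\qquad s_p(c):=\begin{cases}1-e^{-\lambda}(1+\lambda),&p=1,\\1-e^{-\lambda},&p\ge2,\end{cases}$$ $$H_{q,p}(c):=\sum_{\ell=0}^\infty a_\ell|s(\ell)-1|^q\ (1\le q<\infty),\qquad h_p(c):=\sum_{\ell=0}^\infty a_\ell\,s(\ell)\log s(\ell),$$ $$g_p(c):=\begin{cases}\frac{r+1}{r-1}e^{-\lambda(2-r)}-\frac{2}{r-1}e^{-\lambda}-1,&r\ne1,\\(2\lambda+1)e^{-\lambda}-1,&r=1,\end{cases}\qquad H_{\infty,p}(c):=\begin{cases}\frac{e^{-\lambda}}{1-r}-1,&r<1,\\+\infty,&r\ge1.\end{cases}$$ *)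

(* Defs.v *)
From HB Require Import structures.
From mathcomp Require Import all_boot all_order all_algebra all_fingroup.
From mathcomp Require Import all_classical all_reals all_analysis.

Set Implicit Arguments.
Unset Strict Implicit.
Unset Printing Implicit Defensive.

Import Order.TTheory GRing.Theory Num.Theory.
Import numFieldNormedType.Exports.

Local Open Scope classical_set_scope.
Local Open Scope ring_scope.

(* The additive group Z/pZ for every p >= 1, including p = 1 (whereas 'Z_p
   denotes Z/2Z when p = 1).  The value at p = 0 is irrelevant. *)
Definition C_ (p : nat) : finZmodType := 'I_p.-1.+1.

(* (s, sigma): position i carries the label sigma i with color s i.  Labels and
   positions are numbered from 0, so label j of {1, ..., n} is j - 1 here. *)
Definition colored_perm (n p : nat) : Type :=
  ({ffun 'I_n -> C_ p} * 'S_n)%type.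

HB.instance Definition _ n p := Finite.on (colored_perm n p).

Section ColoredPermGroup.
Variables n p : nat.
Implicit Types x y z : colored_perm n p.

(* (t, tau)(s, sigma) = (sigma t + s, tau o sigma), (sigma t)_i = t_{sigma i};
   the product of permutations acts left to right, so that
   tau o sigma is (sigma * tau)%g. *)
Definition cp_mul x y : colored_perm n p :=
  ([ffun i => x.1 (y.2 i) + y.1 i], (y.2 * x.2)%g).

Definition cp_one : colored_perm n p := ([ffun=> 0], 1%g).

Definition cp_inv x : colored_perm n p :=
  ([ffun i => - x.1 ((x.2)^-1%g i)], (x.2)^-1%g).

Lemma cp_mulA : associative cp_mul.
Proof.
move=> [a1 a2] [b1 b2] [c1 c2]; rewrite /cp_mul /= mulgA; congr pair.
by apply/ffunP => i; rewrite !ffunE /= permM addrA.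
Qed.

Lemma cp_mul1 : left_id cp_one cp_mul.
Proof.
move=> [a1 a2]; rewrite /cp_mul /= mulg1; congr pair.
by apply/ffunP => i; rewrite !ffunE add0r.
Qed.

Lemma cp_mulV : left_inverse cp_one cp_inv cp_mul.
Proof.
move=> [a1 a2]; rewrite /cp_mul /cp_one /= mulgV; congr pair.
by apply/ffunP => i; rewrite !ffunE /= permK addNr.
Qed.

End ColoredPermGroup.

HB.instance Definition _ n p := Finite_isGroup.Build (colored_perm n p)
  (@cp_mulA n p) (@cp_mul1 n p) (@cp_mulV n p).

Definition A_ (n p u : nat) : {set colored_perm n p} :=
  [set x : colored_perm n p |
    [forall i : 'I_n, forall j : 'I_n,
       (n - u <= i < j)%N ==> ((x.2)^-1%g i < (x.2)^-1%g j)%N] &&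
    [forall j : 'I_n, (n - u <= j)%N ==> (x.1 ((x.2)^-1%g j) == 0)]].

Section Distances.
Variable R : realType.

Definition unif (T : finType) (A : {set T}) (x : T) : R :=
  (x \in A)%:R / #|A|%:R.

Definition unif_law (T : finType) : T -> R := unif [set: T].

Definition TV (T : finType) (M N : T -> R) : R :=
  2^-1 * \sum_(x : T) `|M x - N x|.

(* The base point 1 makes the iterated minimum that over the whole group. *)
Definition sep (gT : finGroupType) (M N : gT -> R) : R :=
  1 - \big[Num.min/M 1%g / N 1%g]_(x : gT) (M x / N x).

Definition Lq_norm (T : finType) (N : T -> R) (q : R) (f : T -> R) : R :=
  (\sum_(x : T) `|f x| `^ q * N x) `^ q^-1.

Definition Linf_norm (T : finType) (f : T -> R) : R :=
  \big[Num.max/0]_(x : T) `|f x|.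

Definition chi2 (T : finType) (M N : T -> R) : R :=
  Lq_norm N 2 (fun x => M x / N x - 1) ^+ 2.

Definition KL (T : finType) (M N : T -> R) : R :=
  \sum_(x : T) M x * ln (M x / N x).

Definition is_pmf (n : nat) (m : int -> R) : Prop :=
  [/\ forall a, 0 <= m a,
      forall a, ~~ (0 <= a <= n%:Z) -> m a = 0 &
      \sum_(a < n.+1) m a%:Z = 1].

(* Only used for a <= n. *)
Definition Qtilde (n p a : nat) : colored_perm n p -> R :=
  unif (A_ n p (n - a)).

Definition Qmix (n p : nat) (m : int -> R) (x : colored_perm n p) : R :=
  \sum_(u < n.+1) m (n%:Z - u%:Z) * Qtilde (n - u) x.

End Distances.

Arguments unif_law {R T}.

Section Profiles.
Variable R : realType.
Implicit Types (p l : nat) (c q : R).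

Definition lam c : R := expR (- c).
Definition rr p c : R := p%:R * lam c.

Definition s_ p c l : R := expR (- lam c) * \sum_(u < l.+1) rr p c ^+ u.

Definition a_ p l : R :=
  (l`!%:R * p%:R ^+ l)^-1 - (l.+1`!%:R * p%:R ^+ l.+1)^-1.

(* Junk value 0 if no l has s_ p c l > 1, which is impossible for p >= 1:
   see wstarP below. *)
Definition wstar p c : nat :=
  if pselect (exists l, 1 < s_ p c l) is left h then ex_minn h else 0%N.

Definition f_ p c : R :=
  1 - expR (- lam c) * \sum_(u < wstar p c) lam c ^+ u / u`!%:R
    + (expR (- lam c) * (\sum_(u < wstar p c) rr p c ^+ u) - 1)
      / ((wstar p c)`!%:R * p%:R ^+ wstar p c).

Definition sep_lim p c : R :=
  if p == 1%N then 1 - expR (- lam c) * (1 + lam c) else 1 - expR (- lam c).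

(* The series H_ and h_ converge when p >= 1: see is_cvg_H_ and is_cvg_h_. *)
Definition H_ q p c : R :=
  limn (series (fun l => a_ p l * `|s_ p c l - 1| `^ q)).

Definition h_ p c : R :=
  limn (series (fun l => a_ p l * (s_ p c l * ln (s_ p c l)))).

Definition g_ p c : R :=
  let l := lam c in let r := rr p c in
  if r != 1 then
    (r + 1) / (r - 1) * expR (- (l * (2 - r))) - 2 / (r - 1) * expR (- l) - 1
  else (2 * l + 1) * expR (- l) - 1.

Definition Hinf_ p c : \bar R :=
  if rr p c < 1 then (expR (- lam c) / (1 - rr p c) - 1)%:E else +oo%E.

Section WellDefined.
Variables (p : nat) (c : R).
Hypothesis p_gt0 : (0 < p)%N.

Let lam_gt0 : 0 < lam c. Proof. exact: expR_gt0. Qed.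
Let r_gt0 : 0 < rr p c. Proof. by rewrite mulr_gt0 ?ltr0n. Qed.

Lemma s_gt1_ex : exists l, 1 < s_ p c l.
Proof.
have e0 : 0 < expR (- lam c) by exact: expR_gt0.
have [r1|r1] := leP 1 (rr p c).
  exists (Num.truncn (expR (lam c))).
  have : expR (lam c) < (Num.truncn (expR (lam c))).+1%:R.
    by rewrite truncnS_gt.
  set N := Num.truncn _ => hN; rewrite /s_.
  apply: (@lt_le_trans _ _ (expR (- lam c) * N.+1%:R)).
    by rewrite expRN ltr_pdivlMl ?expR_gt0 // mulr1.
  rewrite ler_pM2l //.
  rewrite (_ : N.+1%:R = \sum_(u < N.+1) (1 : R)); last first.
    by rewrite sumr_const card_ord.
  by apply: ler_sum => u _; rewrite exprn_ege1.
have ar : `|rr p c| < 1 by rewrite gtr0_norm.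
have H := @cvg_geometric_series R 1 (rr p c) ar.
have hl : expR (lam c) < 1 * (1 - rr p c)^-1.
  have lr : lam c <= rr p c.
    by rewrite /rr ler_peMl ?ler1n // ltW.
  have h : 1 - lam c < expR (- lam c).
    by apply: expR_gt1Dx; rewrite oppr_eq0 gt_eqF.
  rewrite mul1r -[expR (lam c)]invrK -expRN ltf_pV2 ?posrE ?subr_gt0 //.
  by apply: le_lt_trans h; rewrite lerD2l lerN2.
have := cvgr_gt _ H _ hl.
case=> N _ /(_ N (leqnn N)) /= hN; exists N.
rewrite /s_ expRN mulrC ltr_pdivlMr ?expR_gt0 // mul1r.
apply: (lt_le_trans hN); rewrite seriesEord /=.
rewrite big_ord_recr /= (eq_bigr (fun i : 'I_N => rr p c ^+ i)); last first.
  by move=> i _; rewrite /geometric /= mul1r.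
by rewrite lerDl exprn_ge0 // ltW.
Qed.

Lemma wstarP : [/\ 1 < s_ p c (wstar p c),
  forall l, 1 < s_ p c l -> (wstar p c <= l)%N & (0 < wstar p c)%N].
Proof.
rewrite /wstar; case: pselect => [h|]; last by case; exact: s_gt1_ex.
case: ex_minnP => w hw hmin; split=> //.
case: w hw {hmin} => //; rewrite /s_ big_ord1 expr0 mulr1 expR_gt1.
by rewrite oppr_gt0 ltNge ltW.
Qed.

Lemma a_ge0 l : 0 <= a_ p l.
Proof.
have p0 : (0 : R) < p%:R by rewrite ltr0n.
rewrite /a_ subr_ge0 lef_pV2 ?posrE ?mulr_gt0 ?exprn_gt0 ?ltr0n ?fact_gt0 //.
by rewrite -!natrX -!natrM ler_nat leq_mul ?leq_fact // leq_pexp2l.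
Qed.

Lemma a_le l : a_ p l <= (l`!%:R)^-1.
Proof.
have p0 : (0 : R) < p%:R by rewrite ltr0n.
apply: (@le_trans _ _ (l`!%:R * p%:R ^+ l)^-1).
  by rewrite /a_ gerBl invr_ge0 mulr_ge0 // exprn_ge0 // ltW.
rewrite lef_pV2 ?posrE ?mulr_gt0 ?exprn_gt0 ?ltr0n ?fact_gt0 //.
by rewrite ler_peMr // exprn_ege1 // ler1n.
Qed.

Lemma s_gt0 l : 0 < s_ p c l.
Proof.
rewrite mulr_gt0 ?expR_gt0 // big_ord_recl expr0 ltr_pwDl //.
by apply: sumr_ge0 => i _; rewrite exprn_ge0 // ltW.
Qed.

Lemma s_le l : s_ p c l <= (rr p c + 1) ^+ l.+1 / rr p c.
Proof.
rewrite ler_pdivlMr //.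
apply: (@le_trans _ _ ((\sum_(u < l.+1) (rr p c + 1) ^+ u) * rr p c)).
  rewrite ler_pM2r //; apply: (@le_trans _ _ (\sum_(u < l.+1) rr p c ^+ u)).
    rewrite /s_ ler_piMl // ?sumr_ge0 // => [i _|].
      by rewrite exprn_ge0 // ltW.
    by rewrite -(expR0 R) ler_expR oppr_le0 ltW.
  by apply: ler_sum => i _; rewrite lerXn2r ?nnegrE ?lerDl ?addr_ge0 // ltW.
rewrite mulrC -[X in X * _](addrK 1) -subrX1.
by rewrite lerBlDr lerDl.
Qed.

(* Absolute convergence of \sum_l a_l x_l for x of at most geometric growth. *)
Lemma is_cvg_series_a (x : nat -> R) (C K : R) : 0 <= K ->
  (forall l, `|x l| <= C * K ^+ l) -> cvgn (series (fun l => a_ p l * x l)).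
Proof.
move=> K0 hx; apply: normed_cvg.
apply: (@series_le_cvg _ _ (fun l => C * exp_coeff K l)) => [l|l|l|].
- exact: normr_ge0.
- rewrite mulr_ge0 ?exp_coeff_ge0 //.
  by have := le_trans (normr_ge0 _) (hx 0%N); rewrite expr0 mulr1.
- rewrite /= normrM (ger0_norm (a_ge0 l)) /exp_coeff /= mulrA.
  by rewrite mulrC ler_pM ?a_ge0 ?a_le.
- exact: (@is_cvg_seriesZ _ _ C (is_cvg_series_exp_coeff K)).
Qed.

Lemma is_cvg_H_ q : 0 <= q ->
  cvgn (series (fun l => a_ p l * `|s_ p c l - 1| `^ q)).
Proof.
move=> q0; pose r := rr p c.
pose C := (((r + 1) / r + 1) `^ q).
apply: (@is_cvg_series_a _ C ((r + 1) `^ q)); first exact: powR_ge0.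
move=> l; have r0 : 0 < r := r_gt0.
have k0 : 0 <= r + 1 by rewrite addr_ge0 // ltW.
have -> : (r + 1) `^ q ^+ l = ((r + 1) ^+ l) `^ q.
  by rewrite -!powR_mulrn ?powR_ge0 // -!powRrM mulrC.
rewrite ger0_norm ?powR_ge0 // /C -powRM ?exprn_ge0 //; last first.
  by rewrite addr_ge0 // divr_ge0 // ltW.
apply: ge0_ler_powR => //; rewrite ?nnegrE //.
  by rewrite mulr_ge0 ?exprn_ge0 // addr_ge0 // divr_ge0 // ltW.
apply: (le_trans (ler_normB _ _)); rewrite normr1 (gtr0_norm (s_gt0 l)) mulrDl.
rewrite mul1r lerD //; last by rewrite exprn_ege1 // lerDr ltW.
by apply: (le_trans (s_le l)); rewrite exprS mulrAC.
Qed.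

Lemma is_cvg_h_ :
  cvgn (series (fun l => a_ p l * (s_ p c l * ln (s_ p c l)))).
Proof.
pose r := rr p c.
have r0 : 0 < r := r_gt0.
have k1 : 1 <= r + 1 by rewrite lerDr ltW.
apply: (@is_cvg_series_a _ (((r + 1) / r) ^+ 2 + 1) ((r + 1) ^+ 2)).
  exact: sqr_ge0.
move=> l; set s := s_ p c l; have s0 : 0 < s := s_gt0 l.
have sl : s <= (r + 1) / r * (r + 1) ^+ l.
  by apply: (le_trans (s_le l)); rewrite exprS mulrAC.
apply: (@le_trans _ _ (s ^+ 2 + 1)).
  rewrite ler_norml; apply/andP; split.
    have h : 1 - s^-1 <= ln s.
      have := @le_ln1Dx R (s^-1 - 1).
      rewrite ltrBrDl subrr invr_gt0 s0 addrC subrK lnV // => /(_ isT).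
      by rewrite lerNl opprB.
    have : s * (1 - s^-1) <= s * ln s by rewrite ler_pM2l.
    rewrite mulrBr mulr1 divff ?gt_eqF // => h2.
    apply: le_trans h2; rewrite opprD lerD2r (@le_trans _ _ 0) ?(ltW s0) //.
    by rewrite oppr_le0 sqr_ge0.
  apply: (@le_trans _ _ (s ^+ 2)); last by rewrite lerDl.
  by rewrite expr2 ler_pM2l // ltW // ln_sublinear.
rewrite mulrDl mul1r lerD //; last by rewrite exprn_ege1 // exprn_ege1.
rewrite -exprM mulnC exprM -exprMn.
by rewrite lerXn2r ?nnegrE ?(ltW s0) // (le_trans (ltW s0)).
Qed.

End WellDefined.
End Profiles.

(* Main.v *)
Require Import Defs.
From mathcomp Require Import all_boot all_order all_algebra all_fingroup.
From mathcomp Require Import all_classical all_reals all_analysis.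
From mathcomp Require Import zify ring lra.

(** Let the level of [x] be the largest [u <= n] with [x] in [A_u].  The left
    action of the colored permutations of the top [u] labels is free and meets
    [A_u] exactly once per orbit, so [#|A_u| * u! * p^u = n! * p^n].  Hence the
    density of [M_n] with respect to [U] is [D_n (level x)], where
    [D_n(l) = sum_(u <= l) mu_n(n - u) u! p^u], and [level] takes the value [l]
    with probability [w_n(l) = t_l - t_(l+1)], [t_l = [l <= n] / (l! p^l)].
    The total variation, [L^q] and relative entropy distances are all of the
    form [sum_l w_n(l) F(D_n(l))], and [D_n(l) -> s(l)],
    [w_n(l) -> a_l] with [w_n(l) <= 1 / l!], so dominated convergence of series
    applies; Abel summation evaluates the limits [f_p] and [g_p].  Since
    [D_n] is nondecreasing, separation and the sup norm are read off from [D_n]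
    at the smallest and the largest level. *)

Set Implicit Arguments.
Unset Strict Implicit.
Unset Printing Implicit Defensive.

Import Order.TTheory GRing.Theory Num.Theory.
Import numFieldNormedType.Exports.
Local Open Scope classical_set_scope.
Local Open Scope ring_scope.

(** * Permutations that are increasing on the top indices *)

Lemma rearrangement2_ltn (a b c d : nat) :
  (a < b)%N -> (c < d)%N -> (a * d + b * c < a * c + b * d)%N.
Proof.
move=> ab cd; rewrite -(subnK ab) -(subnK cd).
move: (b - _)%N (d - _)%N => x y.
by rewrite !(mulnDl, mulnDr, mulnS, mulSn); lia.
Qed.

(** Induction on the index gives [i <= t i] everywhere; both sides have the same sum over i, so
    every inequality is an equality. *)
Lemma perm_increasing_eq1 (n m : nat) (t : 'S_n) :
  perm_on [set i : 'I_n | (m <= i)%N] t ->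
  (forall i j : 'I_n, (m <= i < j)%N -> (t i < t j)%N) -> t = 1%g.
Proof.
move=> ton tmono.
have tlt (i : 'I_n) : (i < m)%N -> t i = i.
  by move=> im; apply: (out_perm ton); rewrite inE -ltnNge.
have tge (i : 'I_n) : (m <= i)%N -> (m <= t i)%N.
  by move=> mi; have := perm_closed i ton; rewrite !inE mi => ->.
have le_t : forall k (i : 'I_n), i = k :> nat -> (k <= t i)%N.
  elim=> [//|k IH] i ik; have [im|mi] := ltnP i m; first by rewrite tlt // ik.
  have kn : (k < n)%N by move: (ltn_ord i); rewrite ik; exact: ltnW.
  pose j := Ordinal kn; have [jm|mj] := ltnP j m.
    exact: leq_trans jm (tge _ mi).
  apply: (leq_ltn_trans (IH j erefl)); apply: tmono.
  by rewrite mj /= ik ltnSn.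
have sumt : (\sum_(i < n) t i = \sum_(i < n) i)%N.
  by rewrite [RHS](reindex_inj (@perm_inj _ t)).
apply/permP => i; rewrite perm1; apply/val_inj/eqP => /=.
have := @leqif_sum _ predT (fun i : 'I_n => t i == i) (fun i : 'I_n => val i)
  (fun i : 'I_n => val (t i)).
case=> [k _|_]; first by split; [exact: le_t|rewrite eq_sym].
by rewrite -sumt eqxx => /esym /forall_inP /(_ i isT) /eqP ->.
Qed.

(** Among the permutations supported on the top indices, take one maximizing the sum of i * s (t i).
    A descent i < j could be removed by a transposition, which would raise the sum by the
    rearrangement inequality. *)
Lemma exists_increasing_perm (n m : nat) (s : 'S_n) :
  exists2 t : 'S_n, perm_on [set i : 'I_n | (m <= i)%N] t &
    forall i j : 'I_n, (m <= i < j)%N -> (s (t i) < s (t j))%N.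
Proof.
pose T := [set i : 'I_n | (m <= i)%N]%SET.
have [t ton tmax] := @arg_maxnP 'S_n 1%g (fun t => perm_on T t)
  (fun t => \sum_(i < n) i * s (t i))%N (perm_on1 T).
exists t => // i j /andP[mi ij]; rewrite ltnNge; apply/negP => sji.
have ji : j != i by rewrite -val_eqE gtn_eqF.
have := tmax (tperm i j * t)%g.
have -> : perm_on T (tperm i j * t)%g.
  apply: perm_onM => //; apply/fintype.subsetP => k; rewrite inE => h.
  rewrite inE; move: h; case: tpermP => [-> _|-> _|_ _]; rewrite ?eqxx //.
  by rewrite (leq_trans mi) // ltnW.
move=> /(_ isT); rewrite /geq /= (bigD1 i) //= (bigD1 j) //=.
rewrite [X in (_ <= X)%N -> _](bigD1 i) //=.
rewrite [X in (_ <= _ + X)%N -> _](bigD1 j) //=.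
rewrite !permM tpermL tpermR.
rewrite (eq_bigr (fun k : 'I_n => k * s (t k)))%N; last first.
  by move=> k /andP[ki kj]; rewrite permM tpermD // eq_sym.
have sne : (s (t j) : nat) != s (t i).
  by rewrite val_eqE (inj_eq perm_inj) (inj_eq perm_inj).
have slt : (s (t j) < s (t i))%N by rewrite ltn_neqAle sne.
set rest := (\sum_(_ < n | _) _)%N.
rewrite leqNgt !addnA ltn_add2r.
by move=> /negP; apply; exact: rearrangement2_ltn.
Qed.

(** * Cardinality of [A_] from unique factorization *)

Section TopSubgroup.
Variables (n p u : nat).
Implicit Types (x h : colored_perm n p).

(* The colored permutations that touch only the top [u] labels; their action
   on the left is free and A_u meets each of its orbits in one point. *)
Definition top_perms : {set colored_perm n p} :=
  [set h : colored_perm n p |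
    (h.1 \in pffun_on 0 [set i : 'I_n | (n - u <= i)%N]%SET predT) &&
    perm_on [set i : 'I_n | (n - u <= i)%N]%SET h.2]%SET.

Lemma card_top_perms : (0 < p)%N -> (u <= n)%N ->
  #|top_perms| = (u`! * p ^ u)%N.
Proof.
move=> p_gt0 un; pose T := [set i : 'I_n | (n - u <= i)%N]%SET.
have cT : #|T| = u.
  rewrite -sum1_card (eq_bigl (fun i : 'I_n => (n - u <= i)%N)); last first.
    by move=> i; rewrite inE.
  rewrite -(big_mkord (fun i => (n - u <= i)%N) (fun=> 1%N)).
  rewrite -(big_nat_widenl (n - u) 0 n predT (fun=> 1%N)) //.
  by rewrite sum_nat_const_nat muln1 subKn.
have -> : top_perms = finset.setX [set f : {ffun 'I_n -> C_ p} |
    f \in pffun_on 0 T predT]%SET [set s : 'S_n | perm_on T s]%SET.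
  by apply/finset.setP => h; rewrite !inE.
rewrite cardsX !cardsE card_perm card_pffun_on cT mulnC.
(* [C_ p] is ['I_p.-1.+1], which has p elements because p > 0. *)
by rewrite card_ord prednK.
Qed.

Lemma A_P x : reflect
  ((forall i j : 'I_n, (n - u <= i < j)%N ->
      ((x.2)^-1%g i < (x.2)^-1%g j)%N) /\
   (forall j : 'I_n, (n - u <= j)%N -> x.1 ((x.2)^-1%g j) = 0))
  (x \in A_ n p u).
Proof.
rewrite inE; apply: (iffP andP) => -[H1 H2]; split.
- by move=> i j; apply/implyP; move/forallP: H1 => /(_ i)/forallP/(_ j).
- by move=> j h; apply/eqP; move: h; apply/implyP; move/forallP: H2 => /(_ j).
- by apply/forallP => i; apply/forallP => j; apply/implyP; exact: H1.
- by apply/forallP => j; apply/implyP => h; apply/eqP; exact: H2.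
Qed.

Lemma top_permsP h : reflect
  ((forall i : 'I_n, (i < n - u)%N -> h.1 i = 0) /\
   perm_on [set i : 'I_n | (n - u <= i)%N]%SET h.2)
  (h \in top_perms).
Proof.
rewrite inE; apply: (iffP andP) => -[H1 H2]; split=> //.
- move=> i iu; apply/eqP; apply: contraTT iu => h0.
  move/pffun_onP: H1 => [/supportP H1 _]; rewrite -leqNgt.
  by apply: contraNT h0 => h0; rewrite H1 // inE.
- apply/pffun_onP; split=> //; apply/supportP => i; rewrite inE -ltnNge.
  exact: H1.
Qed.

(** If two products agree, then [sig' = sig * rho] with [rho] supported on the top labels. Both
    inverses increase there, hence so does the inverse of [rho], and [perm_increasing_eq1] gives
    [rho = 1]. The colors then separate: on a low label both [t] and [t'] vanish, on a top label
    both [s] and [s'] do. *)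
Lemma top_perms_mul_inj :
  {in finset.setX top_perms (A_ n p u) &, injective (fun hx => hx.1 * hx.2)%g}.
Proof.
move=> [[t tau] [s sig]] [[t' tau'] [s' sig']].
rewrite !finset.in_setX /= => /andP[/top_permsP[/= t0 tauT] /A_P[/= sigm s0]].
move=> /andP[/top_permsP[/= t0' tauT'] /A_P[/= sigm' s0']].
move=> [] /ffunP eqc eqp.
pose rho := (tau * tau'^-1)%g.
have sig'E : sig' = (sig * rho)%g.
  by rewrite /rho mulgA; apply/(canRL (mulgK tau'))/esym.
have rho1 : rho = 1%g.
  apply: invg_inj; rewrite invg1.
  apply: (@perm_increasing_eq1 _ (n - u)).
    by apply: perm_onV; apply: perm_onM => //; exact: perm_onV.
  have rhoT : perm_on [set i : 'I_n | (n - u <= i)%N]%SET rho^-1%g.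
    by apply: perm_onV; apply: perm_onM => //; exact: perm_onV.
  move=> i j ij.
  have geq (k : 'I_n) : (n - u <= k)%N -> (n - u <= rho^-1%g k)%N.
    by move=> h; have := perm_closed k rhoT; rewrite !inE h.
  have /andP[mi lij] := ij; have mj : (n - u <= j)%N by lia.
  rewrite ltnNge leq_eqVlt; apply/negP => /orP[|lt_ji].
    by rewrite (inj_eq val_inj) (inj_eq perm_inj) -val_eqE gtn_eqF.
  have := sigm' _ _ ij; rewrite sig'E invMg !permM.
  have := sigm (rho^-1%g j) (rho^-1%g i).
  by rewrite geq // lt_ji => /(_ isT) h1 h2; have := ltn_trans h1 h2;
    rewrite ltnn.
have tauE : tau = tau' by move/eqP: rho1; rewrite /rho -eq_mulgV1 => /eqP.
have sigE : sig' = sig by rewrite sig'E rho1 mulg1.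
clear sig'E; subst tau' sig'.
have key i : t (sig i) = t' (sig i) /\ s i = s' i.
  have := eqc i; rewrite !ffunE /=; have [iu|ui] := ltnP (sig i) (n - u).
    rewrite t0 // t0' // => h; split=> //; exact: (@addrI (C_ p) 0 _ _ h).
  have := s0 _ ui; have := s0' _ ui; rewrite permK => -> -> h.
  by split=> //; exact: (@addIr (C_ p) 0 _ _ h).
congr ((_, _), (_, _)); apply/ffunP => i; last by case: (key i).
by case: (key (sig^-1%g i)); rewrite permKV.
Qed.

(** The factor [t] relabels the top labels so that their positions become increasing; [d] absorbs
    the colors of the top labels and [s] keeps the remaining ones. *)
Lemma top_perms_mul_surj x :
  exists hx, hx \in finset.setX top_perms (A_ n p u) /\ x = (hx.1 * hx.2)%g.
Proof.
case: x => c pi; have [t tT tm] := @exists_increasing_perm n (n - u) pi^-1%g.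
pose sig := (pi * t^-1)%g.
pose d := [ffun i : 'I_n => if (n - u <= i)%N then c (sig^-1%g i) else 0].
pose s := [ffun i : 'I_n => c i - d (sig i)].
exists ((d, t), (s, sig)); split.
  rewrite finset.in_setX; apply/andP; split; [apply/top_permsP|apply/A_P];
    split=> //=.
  - by move=> i iu; rewrite ffunE leqNgt iu.
  - by move=> i j ij; rewrite /sig invMg invgK !permM; exact: tm.
  - by move=> j uj; rewrite !ffunE permKV uj subrr.
congr pair; last by rewrite /= /sig mulgKV.
by apply/ffunP => i; rewrite !ffunE /= addrC subrK.
Qed.

Lemma card_A_ : (0 < p)%N -> (u <= n)%N ->
  (u`! * p ^ u * #|A_ n p u| = #|[set: colored_perm n p]%SET|)%N.
Proof.
move=> p_gt0 un; rewrite -card_top_perms // -cardsX.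
rewrite -(card_in_imset top_perms_mul_inj); congr #|pred_of_set _|.
apply/finset.setP => x; rewrite finset.in_setT; apply/imsetP.
by have [hx [h1 h2]] := top_perms_mul_surj x; exists hx.
Qed.

End TopSubgroup.

(** * The law of the level and the density of the mixture *)

Section Level.
Variables (R : realType) (n p : nat).
Hypothesis p_gt0 : (0 < p)%N.
Implicit Types (x : colored_perm n p) (m : int -> R) (F : nat -> R).

Definition level x : nat := (\max_(u < n.+1 | x \in A_ n p u) u)%N.

Lemma A_S u v : (u <= v)%N -> A_ n p v \subset A_ n p u.
Proof.
move=> uv; apply/fintype.subsetP => x /A_P[H1 H2]; apply/A_P; split.
- by move=> i j /andP[ui ij]; apply: H1;
  rewrite ij (leq_trans _ ui) // leq_sub2l.
- by move=> j uj; apply: H2; rewrite (leq_trans _ uj) // leq_sub2l.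
Qed.

Lemma mem_A_0 x : x \in A_ n p 0.
Proof.
by apply/A_P; rewrite subn0; split=> [i j /andP[]|j]; rewrite leqNgt ltn_ord.
Qed.

(** The sets [A_ n p u] decrease in u, so the largest index decides membership; [mem_A_0] makes the
    maximum run over a nonempty set, so that it is attained. *)
Lemma mem_A_level x u : (u <= n)%N -> (x \in A_ n p u) = (u <= level x)%N.
Proof.
rewrite -ltnS => un; apply/idP/idP => [xu|].
  exact: (@leq_bigmax_cond _ _ (fun i : 'I_n.+1 => val i) (Ordinal un)).
have : (0 < #|[pred u : 'I_n.+1 | x \in A_ n p u]|)%N.
  by apply/card_gt0P; exists ord0; rewrite inE mem_A_0.
move=> /(eq_bigmax_cond (fun i : 'I_n.+1 => val i))[v]; rewrite inE => xv.
rewrite /level => -> uv; exact: (fintype.subsetP (A_S uv)).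
Qed.

Lemma level_le x : (level x <= n)%N.
Proof. by apply/bigmax_leqP => i _; rewrite -ltnS. Qed.

Lemma unif_lawE x : unif_law x = #|[set: colored_perm n p]%SET|%:R^-1 :> R.
Proof. by rewrite /unif_law /unif finset.in_setT mul1r. Qed.

Lemma card_colored_perm_gt0 : (0 < #|[set: colored_perm n p]%SET|)%N.
Proof. by apply/card_gt0P; exists 1%g; rewrite finset.in_setT. Qed.

Lemma unif_law_gt0 x : 0 < unif_law x :> R.
Proof. by rewrite unif_lawE invr_gt0 ltr0n card_colored_perm_gt0. Qed.

Lemma card_A_R u : (u <= n)%N ->
  #|A_ n p u|%:R / #|[set: colored_perm n p]%SET|%:R
    = (u`!%:R * p%:R ^+ u)^-1 :> R.
Proof.
move=> un; rewrite -(@card_A_ n p u) // !natrM natrX.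
have A0 : #|A_ n p u|%:R != 0 :> R.
  rewrite pnatr_eq0 -lt0n -(ltn_pmul2l (m := u`! * p ^ u)); last first.
    by rewrite muln_gt0 fact_gt0 expn_gt0 p_gt0.
  by rewrite muln0 card_A_ // card_colored_perm_gt0.
by rewrite invfM mulrCA divff ?mulr1.
Qed.

Definition level_tail (l : nat) : R := (l <= n)%:R / (l`!%:R * p%:R ^+ l).

Lemma sum_level_ge u :
  \sum_x (u <= level x)%:R * unif_law x = level_tail u :> R.
Proof.
rewrite /level_tail; have [un|nu] := leqP u n; last first.
  rewrite mul0r big1 // => x _.
  by rewrite leqNgt (leq_ltn_trans (level_le x) nu) mul0r.
rewrite mul1r -card_A_R // -sum1_card natr_sum mulr_suml [RHS]big_mkcond.
by apply: eq_bigr => x _; rewrite unif_lawE -mem_A_level //; case: ifP;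
  rewrite ?mul0r ?mul1r.
Qed.

(** Expand [F (level x)] over l with coefficient [l <= level x] - [l < level x], which is 1 exactly
    at l = [level x], and exchange the two sums. *)
Lemma sum_level F :
  \sum_x F (level x) * unif_law x
    = \sum_(l < n.+1) (level_tail l - level_tail l.+1) * F l.
Proof.
transitivity (\sum_x \sum_(l < n.+1)
    ((l <= level x)%:R * unif_law x - (l < level x)%:R * unif_law x) * F l).
  apply: eq_bigr => x _.
  have lx : (level x < n.+1)%N by rewrite ltnS level_le.
  rewrite (bigD1 (Ordinal lx)) //= leqnn ltnn mul0r subr0 mul1r mulrC.
  rewrite [X in _ + X]big1 ?addr0 // => l; rewrite -val_eqE /= => lx'.
  by rewrite [(l < _)%N]ltn_neqAle lx' subrr mul0r.
rewrite exchange_big /=; apply: eq_bigr => l _.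
by rewrite -mulr_suml sumrB !sum_level_ge.
Qed.

Definition level_density m (l : nat) : R :=
  \sum_(u < l.+1) m (n%:Z - u%:Z) * u`!%:R * p%:R ^+ u.

(** By [card_A_R], the uniform law on [A_ n p u] has density u! p^u on that set, and x lies in it
    exactly when u is at most the level of x. *)
Lemma Qmix_div_unif m x : Qmix m x / unif_law x = level_density m (level x).
Proof.
have lx : (level x < n.+1)%N by rewrite ltnS level_le.
rewrite /level_density.
rewrite (big_ord_widen _ (fun u => m (n%:Z - u%:Z) * u`!%:R * p%:R ^+ u) lx).
rewrite /Qmix mulr_suml [RHS]big_mkcond; apply: eq_bigr => u _.
have un : (u <= n)%N by rewrite -ltnS.
rewrite /Qtilde /unif subKn // mem_A_level // ltnS.
case: ifP => _; last by rewrite mul0r mulr0 mul0r.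
rewrite mul1r unif_lawE invrK -!mulrA; congr (_ * _).
by apply: invr_inj; rewrite invfM invrK card_A_R.
Qed.

Lemma level_tail_nonincr l : level_tail l.+1 <= level_tail l.
Proof.
rewrite /level_tail; have [ln|nl] := leqP l.+1 n; last first.
  by rewrite mul0r divr_ge0 // mulr_ge0 // exprn_ge0.
rewrite (ltnW ln) !mul1r -subr_ge0; exact: a_ge0.
Qed.

(** Apply [sum_level] to the indicator of l: if no element had level l, its weight would be 0. *)
Lemma ex_level l : (l <= n)%N -> level_tail l.+1 < level_tail l ->
  exists x, level x = l.
Proof.
move=> ln; rewrite -subr_gt0 => wl; apply/not_existsP => nx.
suff : level_tail l - level_tail l.+1 = 0 by move=> w0; rewrite w0 ltxx in wl.
have := sum_level (fun k => (k == l)%:R).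
rewrite big1 => [|x _]; last first.
  by case: eqVneq => [/nx//|_]; rewrite mul0r.
rewrite (bigD1 (Ordinal (ln :
  (l < n.+1)%N))) //= eqxx mulr1 big1 ?addr0 // => k.
by rewrite -val_eqE /= => /negPf ->; rewrite mulr0.
Qed.

Lemma ex_level_max : exists x, level x = n.
Proof.
apply: ex_level => //; rewrite /level_tail ltnn leqnn mul0r mul1r invr_gt0.
by rewrite mulr_gt0 ?ltr0n ?fact_gt0 // exprn_gt0 // ltr0n.
Qed.

End Level.

(** * Dominated convergence of series and continuity of powers *)

Section SeriesLimits.
Variable R : realType.
Implicit Types (f : nat -> nat -> R) (g b : nat -> R).

(** Tannery's theorem: cut at a fixed N, pass to the limit in the finite part, and bound both tails
    by that of b. *)
Lemma cvg_sum_dominated f g b : (forall u, f ^~ u @ \oo --> g u) ->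
  cvgn (series b) -> (\forall n \near \oo, forall u, `|f n u| <= b u) ->
  cvgn (series g) /\ (fun n => \sum_(u < n.+1) f n u) @ \oo --> limn (series g).
Proof.
move=> fg cb fb.
have b0 u : 0 <= b u.
  by have [n /(_ u)] := filter_ex fb; exact: le_trans.
have gb u : `|g u| <= b u.
  have fnu : (fun n => `|f n u|) @ \oo --> `|g u| by exact: cvg_norm.
  have fbu : \forall n \near \oo, `|f n u| <= b u by apply: filterS fb => n.
  exact: (cvgr_to_le fnu fbu).
have cg : cvgn (series g).
  apply: normed_cvg; apply: (@series_le_cvg _ _ b) => // u.
  by rewrite /= normr_ge0.
split=> //; apply/cvgrPdist_le => e e0.
have e3 : 0 < e / 3 by rewrite divr_gt0.
(* One N serves both tails; the third e / 3 is for the finite sum below N. *)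
have [N [gN bN]] : exists N, `|limn (series g) - series g N| <= e / 3 /\
    `|limn (series b) - series b N| <= e / 3.
  have /cvgrPdist_le/(_ _ e3) h1 := cg.
  have /cvgrPdist_le/(_ _ e3) h2 := cb.
  by have [N hN] := filter_ex (filterI h1 h2); exists N.
have fN : \forall n \near \oo,
    `|series g N - \sum_(0 <= u < N) f n u| <= e / 3.
  have : (fun n => \sum_(0 <= u < N) f n u) @ \oo --> series g N.
    by apply: cvg_big => [|u _]; [exact: add_continuous|exact: fg].
  by move/cvgrPdist_le/(_ _ e3).
near=> n.
have Nn : (N <= n.+1)%N by apply: leqW; near: n; exact: nbhs_infty_ge.
have fbn u : `|f n u| <= b u by move: u; near: n.
rewrite -(big_mkord xpredT (f n)) (big_cat_nat _ (n := N)) //=.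
have -> : limn (series g) - (\sum_(0 <= u < N) f n u + \sum_(N <= u < n.+1) f n
  u)
  = (limn (series g) - series g N) + (series g N - \sum_(0 <= u < N) f n u)
    - \sum_(N <= u < n.+1) f n u by ring.
have tail : `|\sum_(N <= u < n.+1) f n u| <= e / 3.
  apply: (le_trans (ler_norm_sum _ _ _)).
  apply: (@le_trans _ _ (\sum_(N <= u < n.+1) b u)).
    by apply: ler_sum => u _.
  apply: le_trans bN; apply: le_trans (ler_norm _).
  rewrite lerBrDr /series /= addrC -big_cat_nat //=.
  apply: (nondecreasing_cvgn_le _ cb).
  by apply: nondecreasing_series => u _ _.
apply: (le_trans (ler_normB _ _));
  apply: le_trans (lerD (ler_normD _ _) (lexx _)) _.
have fn : `|series g N - \sum_(0 <= u < N) f n u| <= e / 3 by near: n.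
lra.
Unshelve. all: by end_near.
Qed.

(** For l > 0 the power is expR (q ln u), a composition of continuous maps. At l = 0 the logarithm
    breaks down, and u^q <= u for u <= 1 squeezes instead. *)
Lemma cvgn_powR (q l : R) (u : nat -> R) : 1 <= q -> (forall n, 0 <= u n) ->
  u @ \oo --> l -> (fun n => u n `^ q) @ \oo --> l `^ q.
Proof.
move=> q1 u0 ul; have q0 : 0 < q by exact: lt_le_trans q1.
have : 0 <= l.
  have un : \forall n \near \oo, 0 <= u n by exact: nearW.
  exact: (cvgr_to_ge ul un).
rewrite le_eqVlt => /predU1P[l0|l0].
  rewrite -l0 powR0 ?gt_eqF //.
  apply: (@squeeze_cvgr _ _ _ _ (fun=> 0) u).
  - near=> n; rewrite powR_ge0 /=.
    have u1 : u n <= 1.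
      by near: n; apply: (cvgr_le _ ul); rewrite -l0.
    have [->|un0] := eqVneq (u n) 0; first by rewrite powR0 ?gt_eqF.
    have ugt0 : 0 < u n by rewrite lt_neqAle eq_sym un0 u0.
    by rewrite -[X in _ <= X]powRr1 // ger_powR // ugt0.
  - exact: cvg_cst.
  - by rewrite l0.
have H : (fun n => expR (q * ln (u n))) @ \oo --> expR (q * ln l).
  apply: (@continuous_cvg _ _ _ _ _ _ (@expR R)); first exact: continuous_expR.
  apply: (@cvgM _ _ \oo _ (fun=> q) (fun n => ln (u n))); first exact: cvg_cst.
  by apply: (@continuous_cvg _ _ _ _ _ _ (@ln R)) => //; exact: continuous_ln.
rewrite /powR (gt_eqF l0); apply: cvg_trans H; apply: near_eq_cvg; near=> n.
by rewrite gt_eqF //; near: n; exact: (cvgr_gt _ ul).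
Unshelve. all: by end_near.
Qed.

End SeriesLimits.

(** * Limits of the densities, the weights and their means *)

Section ProfileLimits.
Variables (R : realType) (p : nat) (c : R) (mu : nat -> int -> R).
Hypothesis p_gt0 : (0 < p)%N.
Hypothesis mu_cvg : forall u : nat, (fun n : nat => mu n (n%:Z - u%:Z)) @ \oo
  --> expR (- lam c) * (lam c ^+ u / u`!%:R).

Let D (n l : nat) : R := level_density n p (mu n) l.
Let w (n l : nat) : R := level_tail R n p l - level_tail R n p l.+1.

Lemma cvg_level_density_term u :
  (fun n => mu n (n%:Z - u%:Z) * u`!%:R * p%:R ^+ u) @ \oo
    --> expR (- lam c) * rr p c ^+ u.
Proof.
have -> : expR (- lam c) * rr p c ^+ u =
    expR (- lam c) * (lam c ^+ u / u`!%:R) * u`!%:R * p%:R ^+ u.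
  have u0 : u`!%:R != 0 :> R by rewrite pnatr_eq0 -lt0n fact_gt0.
  by rewrite /rr exprMn; field.
apply: (@cvgM _ _ \oo _ (fun n => mu n (n%:Z - u%:Z) * u`!%:R) (fun=> _)).
  apply: (@cvgM _ _ \oo _ (fun n => mu n (n%:Z - u%:Z)) (fun=> _)) => //.
  exact: cvg_cst.
exact: cvg_cst.
Qed.

Lemma cvg_level_density l : D ^~ l @ \oo --> s_ p c l.
Proof.
rewrite /s_ mulr_sumr /D /level_density.
by apply: cvg_big => [|u _]; [exact: add_continuous|
  exact: cvg_level_density_term].
Qed.

Lemma level_weight_le n l : `|w n l| <= l`!%:R^-1.
Proof.
have p1 : 1 <= p%:R ^+ l :> R by rewrite exprn_ege1 // ler1n.
have t0 k : 0 <= level_tail R n p k.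
  by rewrite /level_tail divr_ge0 // mulr_ge0 // exprn_ge0.
rewrite ger0_norm ?subr_ge0 ?level_tail_nonincr //.
apply: (@le_trans _ _ (level_tail R n p l)); first by rewrite gerBl.
rewrite /level_tail; case: leqP => _; last by rewrite mul0r invr_ge0.
rewrite mul1r lef_pV2 ?posrE ?mulr_gt0 ?exprn_gt0 ?ltr0n ?fact_gt0 //.
by rewrite ler_peMr.
Qed.

Lemma cvg_level_weight l : w ^~ l @ \oo --> a_ R p l.
Proof.
apply: cvg_near_cst; near=> n.
have ln : (l < n)%N by near: n; exact: nbhs_infty_gt.
by rewrite /w /level_tail ln ltnW // !mul1r.
Unshelve. all: by end_near.
Qed.

(** The weights are at most 1 / l!, so geometric growth of [G] is dominated by C K^l / l!, the terms
    of an exponential series. *)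
Lemma cvg_level_mean (G : nat -> nat -> R) (g : nat -> R) (C K : R) : 0 <= K ->
  (forall l, G ^~ l @ \oo --> g l) ->
  (\forall n \near \oo, forall l, `|G n l| <= C * K ^+ l) ->
  (fun n => \sum_(l < n.+1) w n l * G n l) @ \oo
    --> limn (series (fun l => a_ R p l * g l)).
Proof.
move=> K0 Gg GK.
apply: (proj2 (@cvg_sum_dominated _ (fun n l => w n l * G n l) _
  (fun l => C * exp_coeff K l) _ _ _)).
- by move=> l; apply: cvgM; [exact: cvg_level_weight|exact: Gg].
- exact: (@is_cvg_seriesZ _ _ C (is_cvg_series_exp_coeff K)).
- apply: filterS GK => n GnK l; rewrite normrM /exp_coeff /= mulrA mulrC.
  by rewrite ler_pM // level_weight_le.
Qed.

End ProfileLimits.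

(** * Abel summation and the closed forms of the limits *)

Section Abel.
Variable R : realType.

(** Summation by parts, [a_ R p l] being the difference of consecutive values of 1 / (l! p^l). *)
Lemma sum_a_abel (p N : nat) (E : nat -> R) : (0 < p)%N ->
  \sum_(l < N) a_ R p l * E l.+1 =
  E 0%N + \sum_(l < N) (l`!%:R * p%:R ^+ l)^-1 * (E l.+1 - E l)
    - (N`!%:R * p%:R ^+ N)^-1 * E N.
Proof.
move=> p_gt0; elim: N => [|N IH].
  by rewrite !big_ord0 fact0 expr0 mulr1 invr1 mul1r addr0 subrr.
by rewrite !big_ord_recr /= IH /a_; ring.
Qed.

(* Convertible to s_ p c l at l.+1; the shift starts Abel summation at 0. *)
Definition geo (p : nat) (c : R) (l : nat) : R :=
  expR (- lam c) * \sum_(u < l) rr p c ^+ u.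

Lemma geoS p c l : geo p c l.+1 = geo p c l + expR (- lam c) * rr p c ^+ l.
Proof. by rewrite /geo big_ord_recr /= mulrDr. Qed.

Lemma geo0 p c : geo p c 0 = 0.
Proof. by rewrite /geo big_ord0 mulr0. Qed.

(** After Abel summation this turns the increments of [geo] into exponential series terms in
    [lam c]. *)
Lemma inv_fact_rr (p : nat) (c : R) l : (0 < p)%N ->
  (l`!%:R * p%:R ^+ l)^-1 * rr p c ^+ l = lam c ^+ l / l`!%:R.
Proof.
move=> p_gt0; have p0 : p%:R ^+ l != 0 :> R.
  by rewrite expf_neq0 // pnatr_eq0 -lt0n.
have l0 : l`!%:R != 0 :> R by rewrite pnatr_eq0 -lt0n fact_gt0.
by rewrite /rr exprMn; field; rewrite p0 l0.
Qed.

Lemma s_nondecr (p : nat) (c : R) : {homo s_ p c : l k / (l <= k)%N >-> l <= k}.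
Proof.
apply/nondecreasing_seqP => l; rewrite /s_ ler_pM2l ?expR_gt0 //.
rewrite [leRHS]big_ord_recr /= lerDl exprn_ge0 // mulr_ge0 //.
exact/ltW/expR_gt0.
Qed.

(** The summand carries the negative part of s(l) - 1, which vanishes from [wstar p c] on by
    monotonicity and equals 1 - s(l) before. The series is thus a finite sum, evaluated by
    [sum_a_abel]. *)
Lemma lim_f_ (p : nat) (c : R) : (0 < p)%N ->
  limn (series (fun l => a_ R p l * ((`|s_ p c l - 1| - (s_ p c l - 1)) / 2)))
  = f_ p c.
Proof.
move=> p_gt0; have [sw wmin _] := wstarP c p_gt0.
apply: cvg_lim => //; apply: cvg_near_cst; near=> n.
have wn : (wstar p c <= n)%N by near: n; exact: nbhs_infty_ge.
rewrite /series /= (big_cat_nat _ (n := wstar p c)) //=.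
rewrite [X in _ + X]big_nat_cond [X in _ + X]big1 ?addr0; last first.
  move=> l /andP[/andP[wl _] _].
  rewrite ger0_norm ?subrr ?mul0r ?mulr0 // subr_ge0.
  by apply: (le_trans (ltW sw)); exact: s_nondecr.
rewrite big_mkord (eq_bigr (fun l : 'I__ => a_ R p l * (1 - geo p c l.+1))).
  rewrite (sum_a_abel _ (fun l => 1 - geo p c l)) // geo0 subr0.
  rewrite (eq_bigr (fun l :
    'I__ => - (expR (- lam c) * (lam c ^+ l / l`!%:R)))).
    by rewrite sumrN -mulr_sumr /f_ -/(geo p c (wstar p c)); ring.
  move=> l _; rewrite geoS -(inv_fact_rr c l p_gt0); ring.
move=> l _; congr (_ * _); rewrite ler0_norm; first by rewrite /s_ /geo; field.
by rewrite subr_le0 leNgt; apply/negP => /wmin; rewrite leqNgt ltn_ord.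
Unshelve. all: by end_near.
Qed.

Lemma geo_ge0 (p : nat) (c : R) l : 0 <= geo p c l.
Proof.
rewrite mulr_ge0 ?expR_ge0 // sumr_ge0 // => u _.
by rewrite exprn_ge0 // mulr_ge0 // expR_ge0.
Qed.

(** This is the boundary term of Abel summation in the chi-square series. By [s_le], [geo] grows at
    most geometrically, so the term is at most C K^l / l!, which tends to 0. *)
Lemma cvg_geo_boundary (p : nat) (c : R) : (0 < p)%N ->
  (fun l => (l`!%:R * p%:R ^+ l)^-1 * (geo p c l - 1) ^+ 2) @ \oo --> 0.
Proof.
move=> p_gt0; pose r := rr p c.
have r0 : 0 < r by rewrite mulr_gt0 ?ltr0n ?expR_gt0.
pose C := ((r + 1) / r) ^+ 2 + 1; pose K := (r + 1) ^+ 2.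
have hC : (fun l => C * exp_coeff K l) @ \oo --> 0.
  rewrite -[X in _ --> X](mulr0 C).
  by apply: cvgM; [exact: cvg_cst|exact: cvg_exp_coeff].
apply: (@squeeze_cvgr _ _ _ _ (fun=> 0) (fun l => C * exp_coeff K l)) => //;
  last exact: cvg_cst.
apply: nearW => l; have K1 : 1 <= K by rewrite exprn_ege1 // lerDr ltW.
have p1 : 1 <= p%:R ^+ l :> R by rewrite exprn_ege1 // ler1n.
rewrite mulr_ge0 ?sqr_ge0 ?invr_ge0 ?mulr_ge0 ?exprn_ge0 //=.
rewrite /exp_coeff /= mulrA mulrC ler_pM ?sqr_ge0 //.
- apply: (@le_trans _ _ (geo p c l ^+ 2 + 1)).
    have := geo_ge0 p c l; rewrite sqrrB1; lra.
  rewrite mulrDl mul1r lerD //; last exact: exprn_ege1.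
  rewrite /K -exprM mulnC exprM -exprMn lerXn2r ?nnegrE ?geo_ge0 //.
    by rewrite mulr_ge0 ?exprn_ge0 ?divr_ge0 // ltW // addr_gt0.
  apply: (@le_trans _ _ (s_ p c l)).
    have -> : s_ p c l = geo p c l.+1 by [].
    by rewrite geoS lerDl mulr_ge0 ?expR_ge0 ?exprn_ge0 // ltW.
  by apply: (le_trans (s_le c p_gt0 l)); rewrite exprS mulrAC.
- rewrite lef_pV2 ?posrE ?mulr_gt0 ?exprn_gt0 ?ltr0n ?fact_gt0 //.
  by rewrite ler_peMr.
Qed.

(** [expR x] is by definition the limit of this series, so its convergence suffices. *)
Lemma cvg_expR_series (x : R) : series (exp_coeff x) @ \oo --> expR x.
Proof. exact: is_cvg_series_exp_coeff. Qed.

Lemma H_2E (p : nat) (c : R) : (0 < p)%N -> H_ 2 p c = g_ p c.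
Proof.
move=> p_gt0; pose r := rr p c; pose x := lam c; pose e := expR (- x).
have ex : e * expR x = 1 by rewrite /e mulrC -expRD subrr expR0.
(* Abel summation of (geo - 1)^2 produces differences of squares: the increment e r^l times the last
   factor here. *)
pose V (N : nat) := \sum_(l < N) exp_coeff x l * (geo p c l.+1 + geo p c l - 2).
have partial N : series (fun l => a_ R p l * `|s_ p c l - 1| `^ 2) N =
    1 + e * V N - (N`!%:R * p%:R ^+ N)^-1 * (geo p c N - 1) ^+ 2.
  rewrite seriesEord /= (eq_bigr (fun l :
    'I_N => a_ R p l * (geo p c l.+1 - 1) ^+ 2)).
    rewrite (sum_a_abel _ (fun l => (geo p c l - 1) ^+ 2)) // geo0 sub0r sqrrN
      expr1n.
    congr (_ + _ - _); rewrite mulr_sumr; apply: eq_bigr => l _.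
    have -> : exp_coeff x l = (l`!%:R * p%:R ^+ l)^-1 * r ^+ l.
      by rewrite inv_fact_rr.
    rewrite geoS -/x -/e -/r; ring.
  by move=> l _; rewrite (powR_mulrn 2) // real_normK ?num_real.
(* This target solves 1 + e * lim V = g, the limit of [partial] without its vanishing boundary
   term. *)
suff Vcvg : V @ \oo --> (g_ p c - 1) / e.
  apply: cvg_lim => //; under eq_cvg do rewrite partial.
  rewrite (_ : g_ p c = 1 + e * ((g_ p c - 1) / e) - 0); last first.
    by rewrite subr0 mulrC divfK ?gt_eqF ?expR_gt0 //; ring.
  apply: cvgB; last exact: cvg_geo_boundary.
  by apply: cvgD; [exact: cvg_cst|apply: cvgM; [exact: cvg_cst|]].
have eE : expR x = e^-1 by rewrite /e expRN invrK.
have e0 : e != 0 by rewrite gt_eqF ?expR_gt0.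
have cx := @cvg_expR_series x.
have [r1|r1] := eqVneq r 1.
  (* For r = 1, geo l = e l, and the sum of l x^l / l! is x times the exponential series shifted by
     one index. *)
  have VE N : V N.+1 = e * (2 * (x * series (exp_coeff x) N)
      + series (exp_coeff x) N.+1) - 2 * series (exp_coeff x) N.+1.
    have -> : x * series (exp_coeff x) N
        = \sum_(l < N.+1) l%:R * exp_coeff x l.
      rewrite big_ord_recl mul0r add0r seriesEord mulr_sumr.
      apply: eq_bigr => l _; rewrite lift0 /exp_coeff /= exprS factS natrM.
      have l0 : l`!%:R != 0 :> R by rewrite pnatr_eq0 -lt0n fact_gt0.
      have l1 : l.+1%:R != 0 :> R by rewrite pnatr_eq0.
      by move: (l.+1%:R : R) l1 => a a0; field; rewrite l0 a0.
    rewrite seriesEord /= mulrDr mulrA !mulr_sumr -big_split -sumrB /=.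
    apply: eq_bigr => l _; rewrite geoS -/e /geo -/r r1 expr1n.
    under eq_bigr do rewrite expr1n.
    by rewrite sumr_const card_ord -/x -/e; ring.
  rewrite /g_ -/r r1 eqxx /= -/x -/e -(cvg_shiftS V) /=;
    under eq_cvg do rewrite VE.
  have -> : ((2 * x + 1) * e - 1 - 1) / e
      = e * (2 * (x * expR x) + expR x) - 2 * expR x by rewrite eE; field.
  have cxS : (fun N => series (exp_coeff x) N.+1) @ \oo --> expR x.
    by rewrite (cvg_shiftS (series (exp_coeff x))).
  apply: cvgB; last by apply: cvgM cxS; exact: cvg_cst.
  apply: cvgM; first exact: cvg_cst.
  apply: cvgD => //; apply: cvgM; first exact: cvg_cst.
  by apply: cvgM => //; exact: cvg_cst.
have r10 : r - 1 != 0 by rewrite subr_eq0.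
(* For r != 1 the closed form of the geometric sum splits [V] into exponential series at x r and at
   x. *)
have VE N : V N = e / (r - 1) * ((r + 1) * series (exp_coeff (x * r)) N
      - 2 * series (exp_coeff x) N) - 2 * series (exp_coeff x) N.
  rewrite !seriesEord /= mulrBr ![e / (r - 1) * (_ * _)]mulrA !mulr_sumr
    -!sumrB.
  have geoE l : geo p c l = e * ((r ^+ l - 1) / (r - 1)).
    by rewrite subrX1 mulrAC divff // mul1r.
  apply: eq_bigr => l _; rewrite !geoE /exp_coeff /= (exprMn l x r) (exprS r).
  have l0 : l`!%:R != 0 :> R by rewrite pnatr_eq0 -lt0n fact_gt0.
  by field; rewrite l0 r10.
rewrite /g_ -/r r1 -/x -/e; under eq_cvg do rewrite VE.
have -> : ((r + 1) / (r - 1) * expR (- (x * (2 - r))) - 2 / (r - 1) * e - 1 - 1)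
   / e = e / (r - 1) * ((r + 1) * expR (x * r) - 2 * expR x) - 2 * expR x.
  have -> : - (x * (2 - r)) = - x + (- x + x * r) by ring.
  by rewrite !expRD -/e eE; field; rewrite e0 r10.
have cxr := @cvg_expR_series (x * r).
apply: cvgB; last by apply: cvgM cx; exact: cvg_cst.
apply: cvgM; first exact: cvg_cst.
by apply: cvgB; apply: cvgM => //; exact: cvg_cst.
Qed.
End Abel.

(** * The distances at finite n as functions of the level *)

Section FiniteDistances.
Variables (R : realType) (n p : nat) (m : int -> R).
Hypotheses (p_gt0 : (0 < p)%N) (m_pmf : is_pmf n m).

Let D (l : nat) : R := level_density n p m l.
Let w (l : nat) : R := level_tail R n p l - level_tail R n p l.+1.
Let Q (x : colored_perm n p) : R := Qmix m x.
Let U (x : colored_perm n p) : R := unif_law x.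

Lemma level_density_term_ge0 u : 0 <= m (n%:Z - u%:Z) * u`!%:R * p%:R ^+ u.
Proof. by case: m_pmf => m0 _ _; rewrite !mulr_ge0 ?exprn_ge0. Qed.

Lemma level_density_ge0 l : 0 <= D l.
Proof. by apply: sumr_ge0 => u _; exact: level_density_term_ge0. Qed.

Lemma level_density_nondecr : {homo D : l k / (l <= k)%N >-> l <= k}.
Proof.
apply/nondecreasing_seqP => l; rewrite /D /level_density [leRHS]big_ord_recr /=.
by rewrite lerDl level_density_term_ge0.
Qed.

Lemma QmixE x : Q x = D (level x) * U x.
Proof. by rewrite /D -Qmix_div_unif // divfK // gt_eqF // unif_law_gt0. Qed.

Lemma sum_unif_law : \sum_x U x = 1.
Proof.
rewrite (eq_bigr (fun x => (0 <= level x)%:R * U x)) => [|x _]; last first.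
  by rewrite mul1r.
by rewrite sum_level_ge // /level_tail fact0 expr0 mulr1 invr1 mulr1.
Qed.

Lemma sum_Qmix : \sum_x Q x = 1.
Proof.
have [_ _ m1] := m_pmf; rewrite /Q /Qmix exchange_big /= -m1.
(* [Qmix] is indexed by u, whereas [is_pmf] sums over a = n - u. *)
rewrite (reindex_inj rev_ord_inj) /=; apply: eq_bigr => u _.
have un : (u <= n)%N by rewrite -ltnS.
have -> : n%:Z - (n.+1 - u.+1)%N%:Z = u%:Z by lia.
rewrite -mulr_sumr -[RHS]mulr1 subSS; congr (_ * _).
rewrite /Qtilde /unif subKn ?leq_subr //.
rewrite -mulr_suml -natr_sum -big_mkcond sum1_card divff //.
rewrite pnatr_eq0 -lt0n; have := @card_A_ n p (n - u) p_gt0 (leq_subr _ _).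
have := @card_colored_perm_gt0 n p; case: #|A_ _ _ _| => // h1 h2.
by rewrite -h2 muln0 in h1.
Qed.

(** Since D - 1 has mean 0, half the mean of its absolute value is the mean of its negative part.
    This form is bounded, because D >= 0. *)
Lemma TV_Qmix :
  TV Q U = \sum_(l < n.+1) w l * ((`|D l - 1| - (D l - 1)) / 2).
Proof.
rewrite -(@sum_level _ _ _ p_gt0 (fun l => (`|D l - 1| - (D l - 1)) / 2)) /TV
  mulr_sumr.
have dev : \sum_x (D (level x) - 1) * U x = 0.
  under eq_bigr do rewrite mulrBl mul1r -QmixE.
  by rewrite sumrB sum_Qmix sum_unif_law subrr.
have {}dev : \sum_x 2^-1 * ((D (level x) - 1) * U x) = 0.
  by rewrite -mulr_sumr dev mulr0.
rewrite -[LHS]subr0 -[X in _ - X]dev -sumrB; apply: eq_bigr => x _.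
have -> : Q x - U x = (D (level x) - 1) * U x by rewrite QmixE; ring.
rewrite normrM (gtr0_norm (unif_law_gt0 _ _)) -/(U x).
by field.
Qed.

Lemma Lq_Qmix q : 1 <= q -> Lq_norm U q (fun x => Q x / U x - 1) `^ q
  = \sum_(l < n.+1) w l * `|D l - 1| `^ q.
Proof.
move=> q1; have q0 : q != 0 by rewrite gt_eqF // (lt_le_trans _ q1).
rewrite /Lq_norm -powRrM mulVf // powRr1; last first.
  by apply: sumr_ge0 => x _; rewrite mulr_ge0 ?powR_ge0 // ltW ?unif_law_gt0.
rewrite -(@sum_level _ _ _ p_gt0 (fun l => `|D l - 1| `^ q));
  apply: eq_bigr => x _.
by rewrite /Q /U Qmix_div_unif.
Qed.

Lemma KL_Qmix : KL Q U = \sum_(l < n.+1) w l * (D l * ln (D l)).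
Proof.
rewrite -(@sum_level _ _ _ p_gt0 (fun l => D l * ln (D l)));
  apply: eq_bigr => x _.
have -> : Q x / U x = D (level x) by rewrite /Q /U Qmix_div_unif.
by rewrite QmixE mulrAC.
Qed.

(* When p = 1 the group C_ p is trivial, so that A_0 = A_1. *)
Lemma level_min (x : colored_perm n p) : (0 < n)%N -> ((p == 1) <= level x)%N.
Proof.
case: eqVneq => [p1|//] n0; rewrite -mem_A_level //; apply/A_P; split.
  by move=> i j /andP[ni ij]; have := ltn_ord j; lia.
move=> j _; apply: val_inj.
have := ltn_ord (x.1 ((x.2)^-1%g j)); case: (x.1 _) => k /=; rewrite p1 /=.
by case: k.
Qed.

(** By [ex_level] a positive weight suffices: it is 1 - 1/2 at level 1 when p = 1, and 1 - 1/p at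
    level 0 when p >= 2. *)
Lemma ex_level_min : (1 < n)%N -> exists x : colored_perm n p,
  level x = (p == 1)%N.
Proof.
move=> n1; have p0 : 0 < p%:R :> R by rewrite ltr0n.
apply: (@ex_level R) => //; first by case: eqP => //= _; exact: ltnW.
rewrite /level_tail; case: eqVneq => [->|p1] /=.
  by rewrite n1 ltnW // !mul1r !expr1n !mulr1 ltf_pV2 ?posrE ?ltr0n // ltr1n.
rewrite (ltnW n1) !mul1r.
by rewrite expr0 expr1 invr1 invf_lt1 // ltr1n; lia.
Qed.

Lemma sep_Qmix : (1 < n)%N -> sep Q U = 1 - D (p == 1)%N.
Proof.
move=> n1; congr (1 - _); apply/eqP; rewrite eq_le; apply/andP; split.
  have [x <-] := ex_level_min n1; rewrite /D -Qmix_div_unif //.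
  exact: (bigmin_le _ _ (fun x => Q x / U x)).
by apply: le_bigmin => [|x _]; rewrite /Q /U Qmix_div_unif //;
  apply: level_density_nondecr; exact: level_min (ltnW n1).
Qed.

Lemma Linf_Qmix : (1 < n)%N -> Linf_norm (fun x => Q x / U x - 1) =
  Num.max (1 - D (p == 1)%N) (D n - 1).
Proof.
move=> n1; have devE x : Q x / U x - 1 = D (level x) - 1.
  by rewrite /Q /U Qmix_div_unif.
have D_min (x : colored_perm n p) : D (p == 1)%N <= D (level x).
  by apply: level_density_nondecr; apply: level_min; exact: ltnW.
have D_max (x : colored_perm n p) : D (level x) <= D n.
  by apply: level_density_nondecr; exact: level_le.
rewrite /Linf_norm; under eq_bigr do rewrite devE.
apply/eqP; rewrite eq_le; apply/andP; split.
  set M := Num.max _ _; have M1 : 1 - D (p == 1)%N <= M by rewrite le_max lexx.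
  have M2 : D n - 1 <= M by rewrite le_max lexx orbT.
  (* The two entries of the maximum add up to a nonnegative number, so [M] is at least the base
     value 0 of [Linf_norm]. *)
  have [x _] := ex_level_min n1; have := D_min x; have := D_max x => h1 h2.
  apply: bigmax_le => [|y _]; first lra.
  have := D_min y; have := D_max y; rewrite ler_norml; lra.
rewrite ge_max; apply/andP; split.
  have [x <-] := ex_level_min n1.
  apply: le_trans (le_bigmax _ (fun x => `|D (level x) - 1|) x).
  by rewrite distrC ler_norm.
have [x] := @ex_level_max R n p p_gt0; move=> {1}<-.
by apply: le_trans (le_bigmax _ (fun x => `|D (level x) - 1|) x);
  exact: ler_norm.
Qed.

End FiniteDistances.

(** * Growth bounds for domination *)

(** For x > 0, 1 - 1/x <= ln x <= x gives x - 1 <= x ln x <= x^2. *)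
Lemma normr_mulr_ln_le (R : realType) (x : R) : 0 <= x ->
  `|x * ln x| <= x ^+ 2 + 1.
Proof.
rewrite le_eqVlt => /predU1P[<-|x0].
  by rewrite mul0r normr0 expr0n add0r.
rewrite ler_norml; apply/andP; split.
  have h : 1 - x^-1 <= ln x.
    have := @le_ln1Dx R (x^-1 - 1).
    rewrite ltrBrDl subrr invr_gt0 x0 addrC subrK lnV // => /(_ isT).
    by rewrite lerNl opprB.
  have : x * (1 - x^-1) <= x * ln x by rewrite ler_pM2l.
  rewrite mulrBr mulr1 divff ?gt_eqF //; nra.
have : x * ln x <= x * x by rewrite ler_pM2l // ltW // ln_sublinear.
nra.
Qed.

(** The base B + 1 absorbs the summation: B^(l+1) + (B+1)^(l+1) <= (B+1)^(l+2), as B >= 1. *)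
Lemma level_density_le (R : realType) n p (m : int -> R) (B : R) : 1 <= B ->
  (forall u, m (n%:Z - u%:Z) * u`!%:R * p%:R ^+ u <= B ^+ u) ->
  forall l, level_density n p m l <= (B + 1) * (B + 1) ^+ l.
Proof.
move=> B1 mB; have B0 : 0 <= B by exact: le_trans B1.
elim=> [|l IH]; rewrite /level_density.
  by rewrite big_ord1 (le_trans (mB 0%N)) // !expr0 mulr1 lerDr.
rewrite big_ord_recr /= (le_trans (lerD IH (mB _))) //.
have : B ^+ l.+1 <= (B + 1) ^+ l.+1.
  by rewrite lerXn2r ?nnegrE ?addr_ge0 // lerDl.
rewrite -exprS.
have : 0 <= (B + 1) ^+ l.+1 by rewrite exprn_ge0 ?addr_ge0.
nra.
Qed.

(** * Convergence of the distances *)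

Section Assembly.
Variables (R : realType) (p : nat) (c : R) (mu : nat -> int -> R).
Hypothesis p_gt0 : (0 < p)%N.
Hypothesis mu_pmf : forall n : nat, (0 < n)%N -> is_pmf n (mu n).
Hypothesis mu_cvg : forall u : nat, (fun n : nat => mu n (n%:Z - u%:Z)) @ \oo
  --> expR (- lam c) * (lam c ^+ u / u`!%:R).

Let D (n l : nat) : R := level_density n p (mu n) l.
Let M (n : nat) : colored_perm n p -> R := Qmix (mu n).
Let U (n : nat) : colored_perm n p -> R := unif_law.
Let cvgD1 l : (fun n => D n l - 1) @ \oo --> s_ p c l - 1.
Proof. by apply: cvgB; [exact: cvg_level_density|exact: cvg_cst]. Qed.

Lemma cvg_TV : (fun n => TV (@M n) (@U n)) @ \oo --> f_ p c.
Proof.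
(* The negative part of D - 1 is at most 1, so the domination holds with C = K = 1. *)
rewrite -lim_f_ //.
apply: cvg_trans (@cvg_level_mean R p p_gt0
  (fun n l => (`|D n l - 1| - (D n l - 1)) / 2) _ 1 1 _ _ _) => //.
- apply: near_eq_cvg; near=> n; rewrite TV_Qmix //; apply: mu_pmf.
  by near: n; exact: nbhs_infty_gt.
- move=> l; apply: cvgM; last exact: cvg_cst.
  by apply: cvgB => //; apply: cvg_norm.
near=> n; move=> l; rewrite expr1n mulr1.
have : 0 <= D n l.
  by apply: level_density_ge0; apply: mu_pmf; near: n; exact: nbhs_infty_gt.
rewrite ler_norml; have [|] := ger0P (D n l - 1); lra.
Unshelve. all: by end_near.
Qed.

Let sep_limE : sep_lim p c = 1 - s_ p c (p == 1)%N.
Proof.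
rewrite /sep_lim /s_; case: eqVneq => [->|_] /=.
  by rewrite big_ord_recl big_ord1 expr0 expr1 /rr mul1r.
by rewrite big_ord1 expr0 mulr1.
Qed.

Lemma cvg_sep : (fun n => sep (@M n) (@U n)) @ \oo --> sep_lim p c.
Proof.
rewrite sep_limE.
apply: (@cvg_trans _ ((fun n => 1 - D n (p == 1)%N) @ \oo)).
  apply: near_eq_cvg; near=> n.
  have n1 : (1 < n)%N by near: n; exact: nbhs_infty_gt.
  by rewrite sep_Qmix //; apply: mu_pmf; exact: ltnW.
by apply: cvgB; [exact: cvg_cst|exact: cvg_level_density].
Unshelve. all: by end_near.
Qed.

Section Domination.
Variable B : R.
Hypothesis B1 : 1 <= B.
Hypothesis mu_le : \forall n \near \oo, forall u : nat,
  0 <= mu n (n%:Z - u%:Z) * u`!%:R * p%:R ^+ u <= B ^+ u.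

Let D_le : \forall n \near \oo,
  forall l, 0 <= D n l <= (B + 1) * (B + 1) ^+ l.
Proof.
near=> n; move=> l; apply/andP; split.
  by apply: level_density_ge0; apply: mu_pmf; near: n; exact: nbhs_infty_gt.
apply: level_density_le => // u.
have : forall u, 0 <= mu n (n%:Z - u%:Z) * u`!%:R * p%:R ^+ u <= B ^+ u.
  by near: n.
by move=> /(_ u)/andP[].
Unshelve. all: by end_near.
Qed.

Let B11 : 1 <= B + 1.
Proof. by rewrite lerDr (le_trans _ B1). Qed.

Let B10 : 0 <= B + 1.
Proof. by rewrite addr_ge0 // (le_trans _ B1). Qed.

Lemma cvg_Lq q : 1 <= q ->
  (fun n => Lq_norm (@U n) q (fun x => M x / U x - 1) `^ q) @ \oo --> H_ q p c.
Proof.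
move=> q1; have q0 : 0 <= q by exact: le_trans q1.
(* From 0 <= D <= (B+1)^(l+1) and 1 <= (B+1)^(l+1), |D - 1| is at most (B+1)^(l+1), whose q-th power
   is geometric in l. *)
rewrite /H_; apply: cvg_trans (@cvg_level_mean R p p_gt0
  (fun n l => `|D n l - 1| `^ q) _ ((B + 1) `^ q) ((B + 1) `^ q) _ _ _).
- apply: near_eq_cvg; near=> n.
  have n0 : (0 < n)%N by near: n; exact: nbhs_infty_gt.
  by rewrite Lq_Qmix //; exact: mu_pmf.
- exact: powR_ge0.
- by move=> l; apply: cvgn_powR => //; apply: cvg_norm.
apply: filterS D_le => n Dn l; rewrite ger0_norm ?powR_ge0 //.
have -> : (B + 1) `^ q ^+ l = ((B + 1) ^+ l) `^ q.
  by rewrite -(powR_mulrn l (powR_ge0 _ q)) -(powR_mulrn l B10) -!powRrM mulrC.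
rewrite -powRM ?exprn_ge0 //; apply: ge0_ler_powR => //.
  by rewrite nnegrE mulr_ge0 ?exprn_ge0.
have /andP[D0 DB] := Dn l.
have : 1 <= (B + 1) * (B + 1) ^+ l by rewrite -exprS exprn_ege1.
rewrite ler_norml; lra.
Unshelve. all: by end_near.
Qed.

Lemma cvg_KL : (fun n => KL (@M n) (@U n)) @ \oo --> h_ p c.
Proof.
(* The constants come from |D ln D| <= D^2 + 1 and D <= (B+1)^(l+1). *)
rewrite /h_; apply: cvg_trans (@cvg_level_mean R p p_gt0
  (fun n l => D n l * ln (D n l)) _ ((B + 1) ^+ 2 + 1) ((B + 1) ^+ 2) _ _ _).
- apply: near_eq_cvg; near=> n.
  have n0 : (0 < n)%N by near: n; exact: nbhs_infty_gt.
  by rewrite KL_Qmix //; exact: mu_pmf.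
- exact: sqr_ge0.
- move=> l; apply: cvgM; first exact: cvg_level_density.
  apply: (@continuous_cvg _ _ _ _ _ _ (@ln R)); last exact: cvg_level_density.
  by apply: continuous_ln; exact: s_gt0.
apply: filterS D_le => n Dn l; have /andP[D0 DB] := Dn l.
apply: le_trans (normr_mulr_ln_le D0) _.
rewrite mulrDl mul1r lerD //; last by rewrite -exprM exprn_ege1.
rewrite -exprM mulnC exprM -exprMn lerXn2r ?nnegrE //.
by rewrite mulr_ge0 ?exprn_ge0.
Unshelve. all: by end_near.
Qed.

Lemma cvg_chi2 : (fun n => chi2 (@M n) (@U n)) @ \oo --> H_ 2 p c.
Proof.
rewrite /chi2; under eq_cvg do rewrite -powR_mulrn ?powR_ge0 //.
by apply: cvg_Lq; rewrite ler1n.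
Qed.

End Domination.

(* After multiplication by exp(lambda) this is
   2 exp(lambda) <= 1 / (1 - r) + 1 + (p == 1) * lambda, which holds term by
   term in the power series. *)
Lemma sep_lim_le : rr p c < 1 ->
  sep_lim p c <= expR (- lam c) / (1 - rr p c) - 1.
Proof.
pose r := rr p c; pose x := lam c; pose S := \sum_(u < (p == 1).+1) r ^+ u.
rewrite -/r -/x => r1; have x0 : 0 < x by exact: expR_gt0.
have rE : r = p%:R * x by [].
have p1 : 1 <= p%:R :> R by rewrite ler1n.
have xr : x <= r by rewrite rE ler_peMl // ltW.
have r0 : 0 < r by exact: lt_le_trans xr.
(* The first two degrees, which involve [S], form the base case; from degree 2 on, the factorial is
   at least 2 and x <= r. *)
have partial N :
    2 * series (exp_coeff x) (N + 2)%N <= series (geometric 1 r) (N + 2)%N + S.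
  rewrite addn2; elim: N => [|N IH].
    rewrite !seriesEord /= !big_ord_recl !big_ord0 /exp_coeff /geometric /= /S.
    rewrite !expr0 !expr1 !fact0 !mul1r !addr0 !divr1 invr1.
    case: (eqVneq p 1%N) => [p1E|pn1] /=.
      by rewrite big_ord_recl big_ord1 expr0 expr1 rE p1E !mul1r; lra.
    have p2 : 2 <= p%:R :> R by rewrite ler_nat ltn_neqAle eq_sym pn1.
    rewrite big_ord1 expr0; have : 2 * x <= r by rewrite rE ler_pM2r.
    lra.
  rewrite [series _ N.+3]seriesSr [in leRHS]seriesSr mulrDr.
  suff : 2 * exp_coeff x N.+2 <= geometric 1 r N.+2 by lra.
  rewrite /exp_coeff /geometric /= mul1r mulrA ler_pdivrMr ?ltr0n ?fact_gt0 //.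
  rewrite mulrC; apply: ler_pM => //; first by rewrite exprn_ge0 // ltW.
    by rewrite lerXn2r ?nnegrE // ltW.
  by rewrite ler_nat !factS mulnA (leq_trans _ (leq_pmulr _ (fact_gt0 _))) //;
    lia.
have cl : (fun N => 2 * series (exp_coeff x) (N + 2)%N) @ \oo --> 2 * expR x.
  apply: cvgM; first exact: cvg_cst.
  by rewrite (cvg_shiftn 2 (series (exp_coeff x))); exact: cvg_expR_series.
have cr : (fun N => series (geometric 1 r) (N + 2)%N + S) @ \oo --> 1 / (1 - r)
  + S.
  apply: cvgD; last exact: cvg_cst.
  rewrite (cvg_shiftn 2 (series (geometric 1 r))).
  by apply: cvg_geometric_series; rewrite gtr0_norm.
have : 2 * expR x <= 1 / (1 - r) + S.
  by apply: (ler_cvg_to cl cr); exact: nearW.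
rewrite -(ler_pM2l (expR_gt0 (- x))) mulrCA -expRD addNr expR0 mulr1.
by rewrite sep_limE /s_ -/x -/r -/S mulrDr mulrA mulr1; lra.
Qed.

(** [D n n] is a full sum and tends to the geometric series by [cvg_sum_dominated]. The other entry
    of the maximum tends to [sep_lim p c], which [sep_lim_le] shows to be no larger. *)
Lemma cvg_Linf_lt1 (b : nat -> R) : rr p c < 1 -> cvgn (series b) ->
  (\forall n \near \oo, forall u : nat,
     0 <= mu n (n%:Z - u%:Z) * u`!%:R * p%:R ^+ u <= b u) ->
  (fun n => Linf_norm (fun x => @M n x / @U n x - 1)) @ \oo
    --> expR (- lam c) / (1 - rr p c) - 1.
Proof.
move=> r1 cb mub; have lim_le := sep_lim_le r1.
have r0 : 0 <= rr p c by rewrite mulr_ge0 // expR_ge0.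
have cDn : (fun n => D n n) @ \oo --> expR (- lam c) / (1 - rr p c).
  pose f n u := mu n (n%:Z - u%:Z) * u`!%:R * p%:R ^+ u.
  have fb : \forall n \near \oo, forall u, `|f n u| <= b u.
    by apply: filterS mub => n mubn u; have /andP[f0 fb] := mubn u;
      rewrite ger0_norm.
  have [_] := @cvg_sum_dominated R f (geometric (expR (- lam c)) (rr p c)) b
    (cvg_level_density_term mu_cvg) cb fb.
  have /cvg_lim -> // : series (geometric (expR (- lam c)) (rr p c)) @ \oo
    --> expR (- lam c) / (1 - rr p c).
  by apply: cvg_geometric_series; rewrite ger0_norm.
apply: (@cvg_trans _ ((fun n => Num.max (1 - D n (p == 1)%N) (D n n - 1)) @
  \oo)).
  apply: near_eq_cvg; near=> n.
  have n1 : (1 < n)%N by near: n; exact: nbhs_infty_gt.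
  by rewrite Linf_Qmix //; apply: mu_pmf; exact: ltnW.
have c1 : (fun n => 1 - D n (p == 1)%N) @ \oo --> sep_lim p c.
  by rewrite sep_limE; apply: cvgB; [exact: cvg_cst|exact: cvg_level_density].
have c2 : (fun n => D n n - 1) @ \oo --> expR (- lam c) / (1 - rr p c) - 1.
  by apply: cvgB => //; exact: cvg_cst.
(* Writing the maximum with an absolute value reduces its continuity to that of sums and norms. *)
under eq_cvg do rewrite maxr_absE.
have := maxr_absE (sep_lim p c) (expR (- lam c) / (1 - rr p c) - 1).
rewrite (max_idPr lim_le) => {1}->; apply: cvgM; last exact: cvg_cst.
by apply: cvgD; [exact: cvgD|apply: cvg_norm; exact: cvgB].
Unshelve. all: by end_near.
Qed.

(** For fixed l, [D n n] is eventually at least [D n l], which tends to s(l); these limits are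
    unbounded in l because s(l) >= (l + 1) exp(-lambda) when r >= 1. *)
Lemma cvg_Linf_ge1 : 1 <= rr p c ->
  (fun n => Linf_norm (fun x => @M n x / @U n x - 1)) @ \oo --> +oo.
Proof.
move=> r1; apply/cvgryPge => A.
have [l sl] : exists l, A + 1 < s_ p c l.
  exists (Num.truncn (`|A + 1| * expR (lam c))).
  apply: (le_lt_trans (ler_norm _)); rewrite /s_ expRN.
  rewrite ltr_pdivlMl ?expR_gt0 // mulrC; set y := _ * _.
  apply: (@lt_le_trans _ _ (Num.truncn y).+1%:R); first exact: truncnS_gt.
  rewrite -[in leLHS](card_ord (Num.truncn y).+1) -sumr_const.
  by apply: ler_sum => u _; rewrite exprn_ege1.
have Dl : D ^~ l @ \oo --> s_ p c l by exact: cvg_level_density.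
near=> n.
have n1 : (1 < n)%N by near: n; exact: nbhs_infty_gt.
have ln : (l <= n)%N by near: n; exact: nbhs_infty_ge.
have pn : is_pmf n (mu n) by apply: mu_pmf; exact: ltnW.
rewrite Linf_Qmix // le_max; apply/orP; right.
have : D n l <= D n n by exact: level_density_nondecr.
have : A + 1 < D n l by near: n; exact: (cvgr_gt _ Dl).
by rewrite /D; lra.
Unshelve. all: by end_near.
Qed.

End Assembly.

Theorem theorem1p2 (R : realType) (p : nat) (p_gt0 : (0 < p)%N) (c : R)
    (mu : nat -> int -> R)
    (mu_pmf : forall n : nat, (0 < n)%N -> is_pmf n (mu n))
    (mu_cvg : forall u : nat,
       (fun n : nat => mu n (n%:Z - u%:Z)) @ \oo
         --> expR (- lam c) * (lam c ^+ u / u`!%:R)) :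
  let M (n : nat) : colored_perm n p -> R := Qmix (mu n) in
  let U (n : nat) : colored_perm n p -> R := unif_law in
  let dens (n : nat) (x : colored_perm n p) : R := M n x / U n x - 1 in
  [/\ (fun n : nat => TV (M n) (U n)) @ \oo --> f_ p c /\
      (fun n : nat => sep (M n) (U n)) @ \oo --> sep_lim p c,
      (exists B : R, 1 <= B /\
         \forall n \near \oo, forall u : nat,
           0 <= mu n (n%:Z - u%:Z) * u`!%:R * p%:R ^+ u <= B ^+ u) ->
      [/\ forall q : R, 1 <= q ->
            (fun n : nat => Lq_norm (U n) q (dens n) `^ q) @ \oo --> H_ q p c,
          (fun n : nat => KL (M n) (U n)) @ \oo --> h_ p c,
          (fun n : nat => chi2 (M n) (U n)) @ \oo --> H_ 2 p c &
          H_ 2 p c = g_ p c] &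
      (rr p c < 1 ->
         exists b : nat -> R, cvgn (series b) /\
           \forall n \near \oo, forall u : nat,
             0 <= mu n (n%:Z - u%:Z) * u`!%:R * p%:R ^+ u <= b u) ->
      (fun n : nat => (Linf_norm (dens n))%:E) @ \oo --> Hinf_ p c].
Proof.
move=> M U dens; split.
- by split; [exact: cvg_TV|exact: cvg_sep].
- move=> [B [B1 mu_le]]; split.
  + by move=> q q1; exact: cvg_Lq mu_le _ q1.
  + exact: cvg_KL mu_le.
  + exact: cvg_chi2 mu_le.
  + exact: H_2E.
- move=> mu_le; rewrite /Hinf_; case: ltP => r1.
  + have [b [cb mub]] := mu_le r1; apply: cvg_EFin; first exact: nearW.
    exact: cvg_Linf_lt1 cb mub.
  + by apply/cvgeryP; exact: cvg_Linf_ge1.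
Qed.
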